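(* Let $(F_i,\pi_{i,j})$ be an inverse system of groups indexed by the natural numbers, in which every $F_i$ is a free group of finite rank and every connecting homomorphism $\pi_{i,j}:F_i\to F_j$ ($i\geq j$) is surjective. Let $G=\varprojlim F_i$ be its inverse limit. Then $G$ is isomorphic to $\mathbb{G}$ or to a free group of finite rank, where $\mathbb{G}$ is the standard Hawaiian inverse limit: the inverse limit of the free groups $A_i=\langle \mathbf{a}_1,\dots,\mathbf{a}_i\rangle$ along the homomorphisms that kill the extra generators.
   Context: An inverse system of groups indexed by a partially ordered set $J$ is a family of groups $F_\alpha$ ($\alpha\in J$) together with connecting homomorphisms $\phi_{\alpha,\beta}:F_\alpha\to F_\beta$ for $\alpha\geq\beta$, such that $\phi_{\beta,\gamma}\circ\phi_{\alpha,\beta}=\phi_{\alpha,\gamma}$ whenever $\alpha\geq\beta\geq\gamma$. Its inverse limit is the subgroup of the direct product $\prod_{\alpha\in J}F_\alpha$ consisting of the functions $f$ with $f(\alpha)\in F_\alpha$ and $f(\beta)=\phi_{\alpha,\beta}(f(\alpha))$ for all $\beta\leq\alpha$. The group $\mathbb{G}$ is defined as follows. For each $i\geq 1$ let $A_i=\langle \mathbf{a}_1,\dots,\mathbf{a}_i\rangle$ be the free group on the $i$ generators $\mathbf{a}_1,\dots,\mathbf{a}_i$. For $i\geq j$ let $P_{i,j}:A_i\to A_j$ be the homomorphism sending $\mathbf{a}_k$ to $\mathbf{a}_k$ for $k\leq j$ and $\mathbf{a}_k$ to $1$ for $k>j$. Then $\mathbb{G}$ is the inverse limit of the system $(A_i,P_{i,j})$.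 The trivial group is regarded as the free group of rank $0$. *)

(* Defs.v *)
From HB Require Import structures.
From mathcomp Require Import all_boot all_order.
From mathcomp Require Import boolp.

Set Implicit Arguments.
Unset Strict Implicit.
Unset Printing Implicit Defensive.

Import Order.TTheory.
Local Open Scope group_scope.

Notation "{ 'ghom' G -> H }" := (UMagmaMorphism.type G%type H%type)
  (at level 0, G at level 98, H at level 99,
   format "{ 'ghom'  G  ->  H }") : type_scope.

Definition group_isomorphic (G H : groupType) : Prop :=
  exists f : {ghom G -> H}, bijective f.

(** The letter [(x, true)] stands for the generator [x], and [(x, false)] for
its inverse; the free group is the group of reduced words. *)

Section FreeGroup.
Variable X : choiceType.
Implicit Types (a b : X * bool) (u v w : seq (X * bool)).

Definition inv_letter a : X * bool := (a.1, ~~ a.2).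

Definition reduced w : bool := sorted (fun a b => b != inv_letter a) w.

Record free_group := FreeGroup { word : seq (X * bool); _ : reduced word }.

HB.instance Definition _ := [isSub for word].
HB.instance Definition _ := [Choice of free_group by <:].

Definition reduce_cons a w :=
  if w is b :: w' then if b == inv_letter a then w' else a :: w else [:: a].

Definition reduce_cat u v := foldr reduce_cons v u.

Lemma inv_letterK : involutive inv_letter.
Proof. by case=> x s; rewrite /inv_letter /= negbK. Qed.

Lemma inv_letter_eq a b : (inv_letter a == b) = (a == inv_letter b).
Proof. by rewrite -(inj_eq (can_inj inv_letterK)) inv_letterK. Qed.

Lemma inv_letter_neq a : (a == inv_letter a) = false.
Proof. by case: a => x s; rewrite /inv_letter /= xpair_eqE eqxx; case: s. Qed.

Lemma reduced_behead a w : reduced (a :: w) -> reduced w.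
Proof. by case: w => //= b w /andP[]. Qed.

Lemma reduce_cons_reduced a w : reduced w -> reduced (reduce_cons a w).
Proof.
case: w => //= b w; case: eqP => [_|/eqP nab] /=; last by rewrite nab.
exact: (@reduced_behead b).
Qed.

Lemma reduce_cat_reduced u v : reduced v -> reduced (reduce_cat u v).
Proof. by move=> rv; elim: u => //= a u; apply: reduce_cons_reduced. Qed.

Lemma reduce_consK a w :
  reduced w -> reduce_cons a (reduce_cons (inv_letter a) w) = w.
Proof.
case: w => [|b w] /=; first by rewrite eqxx.
rewrite inv_letterK; have [->|nab] := eqVneq b a; last by rewrite /= eqxx.
by case: w => //= c w /andP[/negbTE-> _].
Qed.

Lemma reduce_cons_id a w : reduced (a :: w) -> reduce_cons a w = a :: w.
Proof. by case: w => //= b w /andP[/negbTE->]. Qed.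

Lemma reduce_cat_cons a u v :
  reduced v -> reduce_cat (reduce_cons a u) v = reduce_cons a (reduce_cat u v).
Proof.
move=> rv; case: u => //= b u; case: eqP => //= ->.
by rewrite reduce_consK// reduce_cat_reduced.
Qed.

Lemma reduce_catA u v w :
  reduced w -> reduce_cat u (reduce_cat v w) = reduce_cat (reduce_cat u v) w.
Proof. by move=> rw; elim: u => //= a u ->; rewrite reduce_cat_cons. Qed.

Lemma reduce_cat0 w : reduced w -> reduce_cat w [::] = w.
Proof.
elim: w => //= a w IHw raw.
by rewrite IHw ?(reduced_behead raw)// reduce_cons_id.
Qed.

Definition inv_word w := rev (map inv_letter w).

Lemma inv_word_reduced w : reduced w -> reduced (inv_word w).
Proof.
rewrite /reduced /inv_word rev_sorted sorted_map.
by apply: sub_sorted => a b /=; rewrite inv_letterK eq_sym inv_letter_eq.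
Qed.

Lemma inv_wordK : involutive inv_word.
Proof. by move=> w; rewrite /inv_word map_rev revK mapK //; apply: inv_letterK. Qed.

Lemma reduce_cat_rcons u a v :
  reduce_cat (rcons u a) v = reduce_cat u (reduce_cons a v).
Proof. by rewrite /reduce_cat foldr_rcons. Qed.

Lemma reduce_catKV w v :
  reduced v -> reduce_cat (inv_word w) (reduce_cat w v) = v.
Proof.
move=> rv; elim: w => //= a w IHw; rewrite /inv_word /= rev_cons reduce_cat_rcons.
rewrite -{2}[a]inv_letterK reduce_consK ?reduce_cat_reduced //.
Qed.

Definition free_one := @FreeGroup [::] isT.
Definition free_mul (g h : free_group) :=
  FreeGroup (reduce_cat_reduced (word g) (valP h)).
Definition free_inv (g : free_group) := FreeGroup (inv_word_reduced (valP g)).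

Fact free_mulA : associative free_mul.
Proof. by move=> g h k; apply/val_inj/reduce_catA/valP. Qed.

Fact free_mul1g : left_id free_one free_mul.
Proof. by move=> g; apply/val_inj. Qed.

Fact free_mulg1 : right_id free_one free_mul.
Proof. by move=> g; apply/val_inj/reduce_cat0/valP. Qed.

Fact free_mulVg : left_inverse free_one free_inv free_mul.
Proof.
move=> g; apply: val_inj; rewrite /= -[X in reduce_cat _ X]reduce_cat0 ?(valP g) //.
exact: reduce_catKV.
Qed.

Fact free_mulgV : right_inverse free_one free_inv free_mul.
Proof.
move=> g; have gK : free_inv (free_inv g) = g.
  by apply: val_inj; rewrite /= inv_wordK.
by rewrite -{1}gK free_mulVg.
Qed.

HB.instance Definition _ :=
  isGroup.Build free_group free_mulA free_mul1g free_mulg1 free_mulVg free_mulgV.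

Definition free_gen (x : X) : free_group := @FreeGroup [:: (x, true)] isT.

End FreeGroup.

Section FreeLift.
Variables (X : choiceType) (H : groupType) (f : X -> H).

Definition eval_letter (a : X * bool) : H := if a.2 then f a.1 else (f a.1)^-1.

Definition free_lift (g : free_group X) : H := \prod_(a <- word g) eval_letter a.

Lemma eval_reduce_cons a w :
  \prod_(b <- reduce_cons a w) eval_letter b
  = eval_letter a * \prod_(b <- w) eval_letter b.
Proof.
case: w => [|b w] /=; first by rewrite big_seq1 big_nil mulg1.
case: eqP => [->|_]; rewrite !big_cons // mulgA.
by case: a => x [] /=; rewrite /eval_letter /= ?mulgV ?mulVg mul1g.
Qed.

Fact free_lift_monoid_morphism : monoid_morphism free_lift.
Proof.
split=> [|g h]; rewrite /free_lift /=; first by rewrite big_nil.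
elim: (word g) => [|a w IHw] /=; first by rewrite big_nil mul1g.
by rewrite eval_reduce_cons IHw big_cons mulgA.
Qed.

HB.instance Definition _ :=
  isUMagmaMorphism.Build (free_group X) H free_lift
    free_lift_monoid_morphism.

Lemma free_lift_gen x : free_lift (free_gen x) = f x.
Proof. by rewrite /free_lift big_seq1. Qed.

Lemma free_lift_unique (h : {ghom free_group X -> H}) :
  (forall x, h (free_gen x) = f x) -> h =1 free_lift.
Proof.
move=> hf; case=> w rw; elim: w rw => [|[x s] w IHw] rw.
  by rewrite (_ : FreeGroup rw = 1) ?gmulf1 //; apply: val_inj.
pose a : free_group X := @FreeGroup _ [:: (x, s)] isT.
have -> : FreeGroup rw = a * FreeGroup (reduced_behead rw).
  by apply: val_inj; rewrite /= reduce_cons_id.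
rewrite !gmulfM IHw; congr (_ * _); rewrite /a; case: (s) => /=.
  by rewrite -/(free_gen x) hf /= free_lift_gen.
have -> : @FreeGroup X [:: (x, false)] isT = (free_gen x)^-1 by apply: val_inj.
by rewrite !gmulfV hf /= free_lift_gen.
Qed.

End FreeLift.

Definition free_of_finite_rank (G : groupType) : Prop :=
  exists n : nat, group_isomorphic G (free_group 'I_n).

Definition direct_prod (J : Type) (F : J -> groupType) : Type := forall a, F a.

Section DirectProd.
Variables (J : Type) (F : J -> groupType).

HB.instance Definition _ := Choice.copy (direct_prod F) (forall a, F a).

Definition dp_one : direct_prod F := fun=> 1.
Definition dp_inv (f : direct_prod F) : direct_prod F := fun a => (f a)^-1.
Definition dp_mul (f g : direct_prod F) : direct_prod F := fun a => f a * g a.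

Fact dp_mulA : associative dp_mul.
Proof. by move=> f g h; apply: functional_extensionality_dep => a; apply: mulgA. Qed.
Fact dp_mul1g : left_id dp_one dp_mul.
Proof. by move=> f; apply: functional_extensionality_dep => a; apply: mul1g. Qed.
Fact dp_mulg1 : right_id dp_one dp_mul.
Proof. by move=> f; apply: functional_extensionality_dep => a; apply: mulg1. Qed.
Fact dp_mulVg : left_inverse dp_one dp_inv dp_mul.
Proof. by move=> f; apply: functional_extensionality_dep => a; apply: mulVg. Qed.
Fact dp_mulgV : right_inverse dp_one dp_inv dp_mul.
Proof. by move=> f; apply: functional_extensionality_dep => a; apply: mulgV. Qed.

HB.instance Definition _ :=
  isGroup.Build (direct_prod F) dp_mulA dp_mul1g dp_mulg1 dp_mulVg dp_mulgV.

End DirectProd.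

(** That [inv_map] is the identity for [a = b] is not required; it follows when
the connecting homomorphisms are surjective. *)
Record inv_system (d : Order.disp_t) (J : porderType d) := InvSystem {
  inv_obj : J -> groupType;
  inv_map : forall a b : J, (b <= a)%O -> {ghom inv_obj a -> inv_obj b};
  inv_map_comp : forall (a b c : J) (ba : (b <= a)%O) (cb : (c <= b)%O)
      (ca : (c <= a)%O) (x : inv_obj a),
    inv_map cb (inv_map ba x) = inv_map ca x
}.

Section InverseLimit.
Variables (d : Order.disp_t) (J : porderType d) (S : inv_system J).

Definition compatible : pred (direct_prod (inv_obj S)) :=
  fun f => `[< forall (a b : J) (ba : (b <= a)%O), f b = inv_map S ba (f a) >].

Record inv_lim := InvLim {
  inv_lim_fun : direct_prod (inv_obj S);
  _ : compatible inv_lim_fun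
}.

HB.instance Definition _ := [isSub for inv_lim_fun].
HB.instance Definition _ := [Choice of inv_lim by <:].

Fact compatible_group_closed : group_closed compatible.
Proof.
split=> [|f g /asboolP fP /asboolP gP]; apply/asboolP => a b ba.
  by rewrite gmulf1.
by rewrite gmulfF -fP -gP.
Qed.

HB.instance Definition _ :=
  SubChoice_isSubGroup.Build _ compatible inv_lim compatible_group_closed.

End InverseLimit.

(** Indices and generators are numbered from 0: [hawaiian_group i] is the free
group on [i.+1] generators, usually written $A_{i+1}$, and [hawaiian_map] kills
the generators whose number is not below [j.+1]. *)

Definition hawaiian_group (i : nat) : groupType := free_group 'I_i.+1.

Definition hawaiian_gen (i : nat) (k : 'I_i.+1) : hawaiian_group i := free_gen k.

Definition hawaiian_map (i j : nat) : {ghom hawaiian_group i -> hawaiian_group j} :=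
  free_lift (fun k : 'I_i.+1 =>
    if insub (val k) is Some k' then hawaiian_gen (k' : 'I_j.+1) else 1).

Lemma hawaiian_map_gen (i j : nat) (k : 'I_i.+1) (k' : 'I_j.+1) :
  k = k' :> nat -> hawaiian_map i j (hawaiian_gen k) = hawaiian_gen k'.
Proof.
move=> kk'; rewrite [LHS]free_lift_gen.
case: insubP => [m _ mE|]; last by rewrite /= kk' ltn_ord.
by congr hawaiian_gen; apply: val_inj; rewrite mE.
Qed.

Lemma hawaiian_map_gen1 (i j : nat) (k : 'I_i.+1) :
  (j < k)%N -> hawaiian_map i j (hawaiian_gen k) = 1.
Proof.
move=> jk; rewrite [LHS]free_lift_gen; case: insubP => // m.
by rewrite ltnNge jk.
Qed.

Fact hawaiian_map_comp (i j k : nat) (ji : (j <= i)%O) (kj : (k <= j)%O)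
    (ki : (k <= i)%O) (x : hawaiian_group i) :
  hawaiian_map j k (hawaiian_map i j x) = hawaiian_map i k x.
Proof.
rewrite /hawaiian_map /= -[LHS]/((free_lift _ \o free_lift _) x).
apply: free_lift_unique => m /=; rewrite free_lift_gen.
case: insubP => [m' _ mE|jm]; first by rewrite free_lift_gen mE.
case: insubP => [m' km _|_]; last by rewrite gmulf1.
by rewrite (leq_trans km) in jm.
Qed.

Definition hawaiian_system : inv_system nat :=
  @InvSystem _ nat hawaiian_group (fun i j _ => hawaiian_map i j)
    hawaiian_map_comp.

Definition hawaiian : groupType := inv_lim hawaiian_system.

(* Main.v *)
From HB Require Import structures.
Require Import Defs.
From mathcomp Require Import all_boot all_order.
From mathcomp Require Import boolp zify.

(**
The heart of the matter is a single step of the system: if [h : G -> H] is a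
surjection between free groups of finite rank and [H] has a basis [B 0], ...,
[B (m - 1)], then [G] has a basis whose first [m] members are mapped to the
[B k] and whose other members are killed ([surjection_adapted_basis]). This is
Nielsen reduction. Among all bases of [G] take one whose image in [H] has the
smallest total weight; the weight of a reduced word is an integer that refines
its length and is unchanged by inversion. Multiplying one basis element by
another one, or by its inverse, gives again a basis
([is_basis_transvection]), so minimality says that no such move lowers the
weight ([nielsen_minimal]). Since the weight refines the length, at most half
of a word of the tuple cancels against a neighbour on either side
([overlap_le]); since the weight also orders words of the same length, the two
neighbours of a word never consume all of it between them ([overlap_sum]). So
every factor of a reduced product leaves a letter behind, and a product of [k]
factors has length at least [k] ([size_prod_reduced]). A generator of [H] has
length 1, so it is a member of the tuple, up to inversion
([nielsen_minimal_generator]). Any further member is trivial, for otherwise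
cancelling its first letter against a generator in the tuple would shorten it
([nielsen_minimal_trivial]). Reordering and inverting the members finishes the
step.

Applying the step along the system gives bases of all the groups which every
connecting homomorphism respects: basis element number [k] goes to basis
element number [k] when the target has one, and to 1 otherwise. With the
convention that a basis is continued by 1 ([std_basis]), the connecting
homomorphisms send [B i k] to [B j k] for all [k], and every equation between
homomorphisms that arises below is checked on these elements.

If the ranks are bounded, the projection of the limit to a group of maximal
rank is an isomorphism ([inv_lim_bounded]), and the limit is free of finite
rank. If they are not, the ranks of the system and those of the system that
defines the standard Hawaiian limit are cofinal in each other, so that each
coordinate of a thread of one system is determined by a coordinate of a thread
of the other, and the two limits are isomorphic ([inv_lim_isomorphic]).
*)

Set Implicit Arguments.
Unset Strict Implicit.
Unset Printing Implicit Defensive.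

Local Open Scope group_scope.

(** * Common prefixes and cancellation *)

Section CommonPrefix.
Variable T : eqType.
Implicit Types s t r : seq T.

(** Length of the longest common prefix. For reduced words it measures the
cancellation in the product of the inverse of [s] with [t]. *)
Fixpoint lcp s t : nat :=
  if s is a :: s' then
    if t is b :: t' then if a == b then (lcp s' t').+1 else 0%N else 0%N
  else 0%N.

Lemma lcpC s t : lcp s t = lcp t s.
Proof. by elim: s t => [|a s IHs] [|b t] //=; rewrite eq_sym IHs. Qed.

Lemma lcp_size s t : (lcp s t <= size s)%N.
Proof.
by elim: s t => [|a s IHs] [|b t] //=; case: eqP => //= _; apply: IHs.
Qed.

Lemma lcp_sizer s t : (lcp s t <= size t)%N.
Proof. by rewrite lcpC lcp_size. Qed.

Lemma take_lcp s t : take (lcp s t) s = take (lcp s t) t.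
Proof.
by elim: s t => [|a s IHs] [|b t] //=; case: eqP => //= ->; rewrite IHs.
Qed.

Lemma lcp_drop s t : lcp (drop (lcp s t) s) (drop (lcp s t) t) = 0%N.
Proof.
elim: s t => [|a s IHs] [|b t] //=; case: (eqVneq a b) => [->|ab] /=.
  exact: IHs.
by rewrite (negbTE ab).
Qed.

Lemma lcp_ge h s t :
  (h <= size s)%N -> (h <= size t)%N -> take h s = take h t ->
  (h <= lcp s t)%N.
Proof.
elim: h s t => [|h IHh] [|a s] [|b t] //= hs ht [-> st].
by rewrite eqxx; apply: IHh.
Qed.

Lemma lcp_cat s t r : (lcp s t < size t)%N -> lcp s (t ++ r) = lcp s t.
Proof.
elim: t s => [|b t IHt] [|a s] //=; case: eqP => // _.
by rewrite ltnS => /IHt->.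
Qed.

(** The common prefix is decided before position [k], so anything may follow. *)
Lemma lcp_take s t r k :
  (lcp s t < k <= size t)%N -> lcp s (take k t ++ r) = lcp s t.
Proof.
move=> /andP[ck kt].
have st : size (take k t) = k by rewrite size_takel.
have ck' : (lcp s (take k t) < size (take k t))%N.
  have := lcp_sizer s (take k t); rewrite leq_eqVlt => /orP[/eqP e|//].
  move: ck; rewrite st in e; rewrite ltnNge lcp_ge //.
    by rewrite -e lcp_size.
  by rewrite -{1}e take_lcp e take_oversize ?st.
by rewrite (lcp_cat _ ck') -[in RHS](cat_take_drop k t) lcp_cat.
Qed.

End CommonPrefix.

Section Words.
Variable X : choiceType.
Implicit Types (a b : X * bool) (s t w : seq (X * bool)) (g h : free_group X).

Lemma inv_letter_index a b : a.1 = b.1 -> a != b -> a = inv_letter b.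
Proof. by case: a b => [i []] [j []] //= -> ; rewrite ?eqxx. Qed.

Lemma size_inv_word w : size (inv_word w) = size w.
Proof. by rewrite size_rev size_map. Qed.

Lemma inv_word_cat s t : inv_word (s ++ t) = inv_word t ++ inv_word s.
Proof. by rewrite /inv_word map_cat rev_cat. Qed.

Lemma inv_word_drop n w :
  inv_word (drop n w) = take (size w - n) (inv_word w).
Proof.
have [wn|/ltnW nw] := leqP (size w) n.
  rewrite drop_oversize // (eqP (_ : size w - n == 0)%N) ?take0 //.
rewrite -{3}(cat_take_drop n w) inv_word_cat take_size_cat //.
by rewrite size_inv_word size_drop.
Qed.

Lemma inv_word_take n w :
  (n <= size w)%N -> inv_word (take n w) = drop (size w - n) (inv_word w).
Proof.
move=> nw; rewrite -{3}(cat_take_drop n w) inv_word_cat drop_size_cat //.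
by rewrite size_inv_word size_drop.
Qed.

Lemma reduced_cat_inv s t :
  reduced s -> reduced t -> lcp s t = 0%N -> reduced (inv_word s ++ t).
Proof.
case: s t => [|a s] [|b t] //= rs rt.
  by move=> _; rewrite cats0; apply: inv_word_reduced.
case: eqP => // /eqP ab _.
move: (@inv_word_reduced _ (a :: s) rs); rewrite /inv_word /= rev_cons.
rewrite cat_rcons; case: (rev _) => [_|c w] /=.
  by rewrite inv_letterK eq_sym ab.
rewrite /reduced /= rcons_path cat_path /= => /andP[-> ->] /=.
by rewrite inv_letterK eq_sym ab.
Qed.

Lemma reduced_drop n w : reduced w -> reduced (drop n w).
Proof. exact: drop_sorted. Qed.

Lemma reduce_cat_id s t : reduced (s ++ t) -> reduce_cat s t = s ++ t.
Proof.
elim: s => //= a s IHs rst; rewrite IHs ?(reduced_behead rst) //.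
exact: reduce_cons_id.
Qed.

(** In [g^-1 * h] exactly the common prefix of [g] and [h] cancels: after its
removal the two words start with different letters. *)
Lemma word_mulVg g h :
  word (g^-1 * h) = inv_word (drop (lcp (word g) (word h)) (word g))
                    ++ drop (lcp (word g) (word h)) (word h).
Proof.
set c := lcp _ _; set z := take c (word h).
have rt : reduced (drop c (word h)) by apply/reduced_drop/(valP h).
have cancel_prefix u v : u = z ++ drop c (word g) ->
    v = reduce_cat z (drop c (word h)) ->
    reduce_cat (inv_word u) v
    = reduce_cat (inv_word (drop c (word g))) (drop c (word h)).
  move=> -> ->; rewrite inv_word_cat [LHS]foldr_cat.
  by rewrite -!/(reduce_cat _ _) reduce_catKV.
have Eg : word g = z ++ drop c (word g).
  by rewrite -[LHS](cat_take_drop c) take_lcp.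
have Eh : word h = reduce_cat z (drop c (word h)).
  by rewrite reduce_cat_id cat_take_drop //; apply: (valP h).
rewrite [LHS](cancel_prefix _ _ Eg Eh) reduce_cat_id //.
by rewrite reduced_cat_inv ?lcp_drop //; apply/reduced_drop/(valP g).
Qed.

Lemma size_mulVg g h :
  size (word (g^-1 * h))
  = (size (word g) + size (word h) - (lcp (word g) (word h)).*2)%N.
Proof.
rewrite word_mulVg size_cat size_inv_word !size_drop.
have := lcp_size (word g) (word h); have := lcp_sizer (word g) (word h).
by move: (lcp _ _) (size (word g)) (size (word h)) => c m n; lia.
Qed.

Lemma word_eq0 g : (size (word g) == 0)%N = (g == 1).
Proof. by rewrite -val_eqE /= size_eq0. Qed.

(** The common prefix of [w] and its inverse is shorter than half of [w]:
otherwise the letter in the middle would be its own inverse, or the two letters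
in the middle would be inverse to each other. *)
Lemma lcp_inv_word w :
  reduced w -> w != [::] -> ((lcp (inv_word w) w).*2 < size w)%N.
Proof.
move=> rw w0; rewrite ltnNge; apply/negP => wc.
set c := lcp _ _ in wc.
have cw : (c <= size w)%N by apply: lcp_sizer.
have [a _] : exists a, a \in w.
  by case: (w) w0 => // a v _; exists a; rewrite inE eqxx.
have nthE i : (i < c)%N -> inv_letter (nth a w (size w - i.+1)) = nth a w i.
  move=> ic; have := congr1 (fun v => nth a v i) (take_lcp (inv_word w) w).
  rewrite !nth_take // => <-; rewrite nth_rev ?size_map ?(leq_trans ic) //.
  by rewrite (nth_map a) //; lia.
have [] := boolP (odd (size w)) => ow.
  have /(_ _) := nthE (size w)./2.
  have <- : (size w)./2 = (size w - (size w)./2.+1)%N by lia.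
  by move=> /(_ ltac:(lia))/eqP; rewrite eq_sym inv_letter_neq.
have w2 : (0 < (size w)./2)%N by case: (w) w0 ow => // x [|].
have := nthE (size w)./2.-1 ltac:(lia).
have -> : (size w - (size w)./2.-1.+1)%N = (size w)./2 by lia.
move/esym/eqP; rewrite -inv_letter_eq eq_sym => /eqP e.
have /(sortedP a)/(_ (size w)./2.-1) := rw.
rewrite prednK // => /(_ ltac:(lia)).
by rewrite e eqxx.
Qed.

End Words.

(** * Homomorphisms out of free groups *)

Lemma eval_letter_inv (X : choiceType) (G : groupType) (b : X -> G)
    (a : X * bool) :
  eval_letter b (inv_letter a) = (eval_letter b a)^-1.
Proof. by case: a => x [] //=; rewrite /eval_letter /= invgK. Qed.

Lemma ghom_inverse (G H : groupType) (f : {ghom G -> H}) :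
  bijective f -> exists g : {ghom H -> G}, cancel f g /\ cancel g f.
Proof.
case=> g fK gK.
have gM : monoid_morphism g.
  by split=> [|x y]; apply: (can_inj fK); rewrite ?gmulfM !gK ?gmulf1.
pose gI := isUMagmaMorphism.Build H G g gM.
pose g' : {ghom H -> G} := HB.pack g gI.
by exists g'.
Qed.

Lemma ghom_eval_letter (X : choiceType) (G H : groupType) (h : {ghom G -> H})
    (b : X -> G) (a : X * bool) :
  h (eval_letter b a) = eval_letter (h \o b) a.
Proof. by rewrite /eval_letter; case: ifP => //= _; rewrite gmulfV. Qed.

Lemma free_hom_ext (X : choiceType) (H : groupType)
    (h k : {ghom free_group X -> H}) :
  (forall x, h (free_gen x) = k (free_gen x)) -> h =1 k.
Proof.
move=> hk g; rewrite (free_lift_unique (f := k \o @free_gen X) hk).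
by rewrite -(free_lift_unique (h := k)).
Qed.

Lemma ghom_free_lift (X : choiceType) (G H : groupType) (h : {ghom G -> H})
    (b : X -> G) :
  h \o free_lift b =1 free_lift (h \o b).
Proof. by apply: free_lift_unique => x /=; rewrite free_lift_gen. Qed.

(** Letters with a trivial value can be dropped before reducing, because
reduction does not create letters. *)
Lemma free_lift_nontrivial_word (X : choiceType) (G : groupType) (b : X -> G)
    (g : free_group X) :
  exists2 w, reduced w && all (fun a => eval_letter b a != 1) w
  & free_lift b g = \prod_(a <- w) eval_letter b a.
Proof.
exists (reduce_cat [seq a <- word g | eval_letter b a != 1] [::]).
  rewrite reduce_cat_reduced //=; elim: (word g) => //= a w IHw.
  case: ifP => //= ba; case: (reduce_cat _ _) IHw => [|c w'] /=.
    by rewrite ba.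
  by case: ifP => _ /= /andP[bc bw']; rewrite ?ba ?bc.
rewrite /free_lift; elim: (word g) => [|a w IHw] /=; first by rewrite !big_nil.
rewrite big_cons IHw; case: ifP => [_|/negbFE/eqP->] /=; last by rewrite mul1g.
by rewrite eval_reduce_cons.
Qed.

(** * Bases of free groups *)

Definition is_basis (X : choiceType) (G : groupType) (b : X -> G) :=
  bijective (free_lift b).

Lemma is_basis_change (X Y : choiceType) (G : groupType) (b : X -> G)
    (t : Y -> free_group X) :
  is_basis b -> bijective (free_lift t) -> is_basis (free_lift b \o t).
Proof.
move=> bB tB; apply: (eq_bij (bij_comp bB tB)).
exact: ghom_free_lift.
Qed.

Lemma bijective_free_lift (X Y : choiceType) (t : X -> free_group Y)
    (s : Y -> free_group X) :
  (forall x, free_lift s (t x) = free_gen x) ->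
  (forall y, free_lift t (s y) = free_gen y) -> bijective (free_lift t).
Proof.
move=> st ts; exists (free_lift s) => g.
  apply: (free_hom_ext (h := free_lift s \o free_lift t) (k := idfun)) => x /=.
  by rewrite free_lift_gen st.
apply: (free_hom_ext (h := free_lift t \o free_lift s) (k := idfun)) => x /=.
by rewrite free_lift_gen ts.
Qed.

Lemma is_basis_free_gen (X : choiceType) : is_basis (@free_gen X).
Proof.
apply: (bijective_free_lift (s := @free_gen X)) => x; exact: free_lift_gen.
Qed.

(** A basis may be permuted and some of its elements inverted: the component
[(p y).2] is the sign given to the element number [(p y).1]. *)
Lemma is_basis_reindex (X Y : choiceType) (G : groupType) (b : X -> G)
    (p : Y -> X * bool) :
  is_basis b -> bijective (fun y => (p y).1) ->
  is_basis (fun y => eval_letter b (p y)).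
Proof.
move=> bB [q pK qK]; pose t y := eval_letter (@free_gen X) (p y).
have -> : (fun y => eval_letter b (p y)) = free_lift b \o t.
  apply/funext => y /=; rewrite ghom_eval_letter; congr eval_letter.
  by apply/funext => x /=; rewrite free_lift_gen.
apply: is_basis_change => //.
pose s x := eval_letter (@free_gen Y) (q x, (p (q x)).2).
apply: (bijective_free_lift (s := s)) => [y|x].
  rewrite ghom_eval_letter {1}/eval_letter /= free_lift_gen /s pK.
  by case: ifP => [e|e]; rewrite /eval_letter /= e ?invgK.
rewrite ghom_eval_letter {1}/eval_letter /= free_lift_gen /t.
by case: ifP => [e|e]; rewrite /eval_letter /= qK e ?invgK.
Qed.

(** The elementary Nielsen move, stated for letters so that all four sign
patterns are treated at once. Its inverse is the same move with [c] replaced by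
the inverse letter. *)
Lemma is_basis_transvection (X : choiceType) (G : groupType) (b : X -> G)
    (a c : X * bool) :
  is_basis b -> a.1 != c.1 ->
  exists b' : X -> G, [/\ is_basis b', forall x, x != a.1 -> b' x = b x
    & eval_letter b' a = (eval_letter b c)^-1 * eval_letter b a].
Proof.
move=> bB ac.
pose L := eval_letter (@free_gen X).
have Linv d : L (inv_letter d) = (L d)^-1 := eval_letter_inv _ d.
(* To multiply [(x, false)] by [L c'^-1] on the left is to multiply the
   generator [x] by [L c'] on the right. *)
pose t c' x := if x == a.1 then
    if a.2 then (L c')^-1 * free_gen x else free_gen x * L c'
  else free_gen x.
have tK c' c'' : c'.1 = c.1 -> c'' = inv_letter c' ->
    forall x, free_lift (t c') (t c'' x) = free_gen x.
  move=> e' -> x; rewrite {2}/t.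
  have tc : free_lift (t c') (L c') = L c'.
    rewrite ghom_eval_letter /L /eval_letter /= free_lift_gen /t eq_sym e'.
    by rewrite (negbTE ac).
  have [->|xa] := eqVneq x a.1; last by rewrite free_lift_gen /t (negbTE xa).
  rewrite Linv.
  by case: ifP => e; rewrite gmulfM !gmulfV /= tc free_lift_gen /t eqxx e
    ?invgK ?mulVKg ?mulKVg ?mulgK ?mulgVK.
exists (free_lift b \o t c); split.
- apply: is_basis_change => //.
  by apply: (bijective_free_lift (s := t (inv_letter c))); apply: tK => //;
    rewrite inv_letterK.
- by move=> x xa; rewrite /= /t (negbTE xa) free_lift_gen.
have bc : free_lift b (L c) = eval_letter b c.
  by rewrite ghom_eval_letter /eval_letter /= free_lift_gen.
rewrite -bc [LHS]/eval_letter [in RHS]/eval_letter /= /t eqxx.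
by case: (a.2); rewrite gmulfM /= ?gmulfV free_lift_gen ?invgM.
Qed.

(** A basis of rank [n], continued by 1. With this convention a homomorphism
that matches the first basis elements and kills the others is simply one that
sends [B k] to [C k] for all [k]. *)
Definition std_basis (G : groupType) (n : nat) (B : nat -> G) :=
  (forall k, (n <= k)%N -> B k = 1) /\ is_basis (fun k : 'I_n => B k).

Definition extend (G : groupType) (n : nat) (b : 'I_n -> G) (k : nat) : G :=
  if insub k is Some i then b i else 1.

Lemma extend_ord (G : groupType) (n : nat) (b : 'I_n -> G) (i : 'I_n) :
  extend b i = b i.
Proof. by rewrite /extend valK. Qed.

Lemma extend_ge (G : groupType) (n : nat) (b : 'I_n -> G) k :
  (n <= k)%N -> extend b k = 1.
Proof. by move=> nk; rewrite /extend insubF // ltnNge nk. Qed.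

Lemma std_basis_extend (G : groupType) (n : nat) (b : 'I_n -> G) :
  is_basis b -> std_basis n (extend b).
Proof.
move=> bB; split; first exact: extend_ge.
by rewrite (_ : (fun _ => _) = b) //; apply/funext => i; rewrite extend_ord.
Qed.

Lemma std_basis_hom_ext (G H : groupType) (n : nat) (B : nat -> G)
    (h k : {ghom G -> H}) :
  std_basis n B -> (forall i, h (B i) = k (B i)) -> h =1 k.
Proof.
move=> [_ [l liftK lK]] hk g; rewrite -(lK g).
apply: (free_hom_ext (h := h \o free_lift _) (k := k \o free_lift _)) => i /=.
by rewrite free_lift_gen.
Qed.

(** The inequality [m <= n] is needed because [B k] is trivial from [n] on. *)
Lemma std_basis_hom (G H : groupType) (m n : nat) (B : nat -> G)
    (C : nat -> H) :
  std_basis n B -> std_basis m C -> (m <= n)%N ->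
  exists h : {ghom G -> H}, forall i, h (B i) = C i.
Proof.
move=> [Bge BB] [Cge _] mn; have [l [liftK lK]] := ghom_inverse BB.
pose h : {ghom free_group 'I_n -> H} := free_lift (fun i : 'I_n => C i).
exists (h \o l) => i; have [ni|ilt] := leqP n i.
  by rewrite Bge // gmulf1 Cge // (leq_trans mn).
have -> : B i = free_lift (fun k : 'I_n => B k) (free_gen (Ordinal ilt)).
  by rewrite free_lift_gen.
by rewrite /= liftK [LHS]free_lift_gen.
Qed.

(** * A weight on reduced words *)

Section Weight.
Variable X : finType.
Implicit Types (a : X * bool) (p q r s t w : seq (X * bool)).

Let base : nat := #|{: X * bool}|.+1.

Definition letter_digit a : nat := (enum_rank a).+1.

(** The word read as a numeral with nonzero digits, first letter most
significant: words of the same length are thereby ordered lexicographically. *)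
Fixpoint word_value w : nat :=
  if w is a :: w' then (letter_digit a * base ^ size w' + word_value w')%N
  else 0%N.

Lemma word_value_lt w : (word_value w < base ^ size w)%N.
Proof.
elim: w => [|a w IHw] //=; rewrite expnS /base mulSn addnC -/base.
by rewrite -addSn leq_add // leq_mul2r ltn_ord orbT.
Qed.

Lemma word_value_ge a w : (base ^ size w <= word_value (a :: w))%N.
Proof. by rewrite /= /letter_digit mulSn -addnA leq_addr. Qed.

Lemma word_value_cat s t :
  word_value (s ++ t) = (word_value s * base ^ size t + word_value t)%N.
Proof. by elim: s => //= a s ->; rewrite size_cat expnD; lia. Qed.

Lemma word_value_inj s t :
  size s = size t -> word_value s = word_value t -> s = t.
Proof.
elim: s t => [|a s IHs] [|b t] //= [st]; rewrite st => e.
have sb := word_value_lt s; have tb := word_value_lt t; rewrite st in sb.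
have B0 : (0 < base ^ size t)%N by rewrite expn_gt0.
have ab : letter_digit a = letter_digit b.
  move/(congr1 (divn^~ (base ^ size t)%N)): e.
  by rewrite !divnMDl // !divn_small // !addn0.
have -> : a = b by move: ab => [] /val_inj/enum_rank_inj.
by rewrite (IHs t) //; move: e; rewrite ab => /addnI.
Qed.

(** The value of the inverse is added for invariance under inversion. *)
Definition weight w : nat := (word_value w + word_value (inv_word w))%N.

Lemma weight_inv w : weight (inv_word w) = weight w.
Proof. by rewrite /weight inv_wordK addnC. Qed.

(** The weight of [s] is below twice [base ^ size s]. As no digit is 0, the
weight of a longer word is at least that number. *)
Lemma weight_lt_size s t : (size s < size t)%N -> (weight s < weight t)%N.
Proof.
case/lastP: t => // t b; rewrite size_rcons ltnS => st.
have sb := word_value_lt s; have sb' := word_value_lt (inv_word s).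
rewrite size_inv_word in sb'.
have tb' : (base ^ size t <= word_value (inv_word (rcons t b)))%N.
  by rewrite /inv_word map_rcons rev_rcons -(size_inv_word t) word_value_ge.
have tb : (base ^ size t <= word_value (rcons t b))%N.
  case: (t) => [|a u] /=; first exact: word_value_ge [::].
  by rewrite size_rcons; apply: leq_trans (leq_addr _ _); rewrite leq_pmull.
have : (base ^ size s <= base ^ size t)%N by rewrite leq_pexp2l.
rewrite /weight => le_st; apply: leq_trans (leq_add tb tb').
by rewrite -addSn leq_add // (leq_trans _ le_st) // ltnW.
Qed.

(** Changing [p] to [q] gains at least [base ^ size r] in the word itself. In
the inverse, where [p] is at the end, it loses less than [base ^ size p], which
is no more since the changed prefix is at most half of the word. *)
Lemma weight_lt_prefix p q r :
  size p = size q -> (size p <= size r)%N -> (word_value p < word_value q)%N ->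
  (weight (p ++ r) < weight (q ++ r))%N.
Proof.
move=> pq pr vpq; rewrite /weight !inv_word_cat !word_value_cat.
rewrite !size_inv_word -pq.
have := word_value_lt (inv_word p); rewrite size_inv_word => pb.
have : (base ^ size p <= base ^ size r)%N by rewrite leq_pexp2l.
move: (base ^ size p)%N (base ^ size r)%N pb => P R pb PR.
move: (word_value (inv_word p)) (word_value (inv_word r) * P)%N pb => ip irP pb.
have : (word_value p * R + R <= word_value q * R)%N.
  by rewrite -[X in (_ + X)%N]mul1n -mulnDl leq_mul2r addn1 vpq orbT.
by lia.
Qed.

End Weight.

(** * Nielsen-minimal tuples *)

Section Nielsen.
Variables (I : choiceType) (X : finType) (f : I -> free_group X).
Implicit Types a b c : I * bool.

Local Notation u := (eval_letter f).
Local Notation ov a b := (lcp (word (u a)) (word (u b))).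

(** No elementary Nielsen move lowers the weight. For [n]-tuples this is what
remains of minimality of the total weight, because such a move changes a single
member. *)
Definition nielsen_minimal := forall a b, a.1 != b.1 ->
  (weight (word (u a)) <= weight (word ((u b)^-1 * u a)%g))%N.

Hypothesis fmin : nielsen_minimal.

Lemma word_eval_inv a : word (u (inv_letter a)) = inv_word (word (u a)).
Proof. by rewrite eval_letter_inv. Qed.

Lemma size_eval_inv a : size (word (u (inv_letter a))) = size (word (u a)).
Proof. by rewrite word_eval_inv size_inv_word. Qed.

Lemma overlap_self a :
  u a != 1 -> ((ov (inv_letter a) a).*2 < size (word (u a)))%N.
Proof.
move=> ua; rewrite word_eval_inv.
apply: lcp_inv_word; first exact: (valP (u a)).
by rewrite -size_eq0 word_eq0.
Qed.

(** If more than half of [u b] cancelled in [(u b)^-1 * u a], this product would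
be shorter than [u a]. When [a] and [b] have the same index they are inverse
letters, and [overlap_self] applies. *)
Lemma overlap_le a b :
  a != b -> u a != 1 -> ((ov a b).*2 <= size (word (u b)))%N.
Proof.
move=> ab ua; have [e|ne] := eqVneq a.1 b.1.
  have ub : u b != 1.
    by rewrite (inv_letter_index e ab) eval_letter_inv invg_eq1 in ua.
  by rewrite (inv_letter_index e ab) ltnW // overlap_self.
rewrite leqNgt; apply/negP => lt.
have := fmin ne; rewrite leqNgt weight_lt_size //.
rewrite -(size_inv_word (word (_ * _))) -[inv_word _]/(word (_ * _)^-1).
rewrite invgM invgK size_mulVg.
have := lcp_sizer (word (u a)) (word (u b)).
have := lcp_size (word (u a)) (word (u b)).
move: lt; move: (lcp _ _) (size (word (u a))) (size (word (u b))) => c m n; lia.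
Qed.

(** If exactly half of [u b], namely [p], cancels in [(u b)^-1 * u a], then the
move replaces the prefix [p] of [u a] by [q] without changing its length. *)
Lemma overlap_half_value a b h p q :
  a.1 != b.1 -> u a != 1 -> u b != 1 -> ov b a = h ->
  word (u b) = p ++ inv_word q -> size p = h -> size q = h ->
  (word_value p <= word_value q)%N.
Proof.
move=> ab ua ub ovh wb ph qh; rewrite leqNgt; apply/negP => qp.
have wa : word (u a) = p ++ drop h (word (u a)).
  rewrite -{1}(cat_take_drop h (word (u a))) -{1}ovh -take_lcp ovh wb.
  by rewrite take_size_cat.
have ah : (h.*2 <= size (word (u a)))%N.
  by rewrite -ovh overlap_le //; apply: contraNneq ab => ->.
have := fmin ab; rewrite leqNgt word_mulVg ovh {1}wb drop_size_cat // inv_wordK.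
rewrite {2}wa weight_lt_prefix ?ph ?qh // size_drop.
by move: ah; move: (size (word (u a))) => n; lia.
Qed.

(** Each of the two overlaps is at most half of [u b]. If both are half of it,
write [u b] as [p q^-1]. Minimality on the side of [a] and on the side of [c]
gives opposite inequalities between [p] and [q], so [p = q] and [u b] would be
trivial. *)
Lemma overlap_sum a b c :
  a != b -> c != inv_letter b -> u a != 1 -> u b != 1 -> u c != 1 ->
  (ov a b + ov (inv_letter b) c < size (word (u b)))%N.
Proof.
move=> ab cb ua ub uc.
have ub' : u (inv_letter b) != 1 by rewrite eval_letter_inv invg_eq1.
have lab := overlap_le ab ua.
have lcb := overlap_le cb uc; rewrite size_eval_inv [lcp _ _]lcpC in lcb.
move hab : (ov a b) lab => h lab; rewrite ltnNge; apply/negP => le.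
(* The two upper bounds leave only the case of equality. *)
have hc : ov (inv_letter b) c = h.
  by move: lab lcb le; move: (lcp _ _) (size _) => x z; lia.
have hb : size (word (u b)) = h.*2.
  by move: lab lcb le; rewrite hc; move: (size _) => z; lia.
have ab1 : b.1 != a.1.
  apply: contraTneq (overlap_self ub) => e.
  by rewrite -(inv_letter_index (esym e) ab) hab hb ltnn.
have cb1 : c.1 != (inv_letter b).1.
  apply: contraTneq (overlap_self ub) => e.
  move: hc; rewrite (inv_letter_index e cb) inv_letterK => ->.
  by rewrite hb ltnn.
set p := take h (word (u b)); set q := take h (word (u (inv_letter b))).
have h_half : (h <= h.*2)%N by rewrite -addnn leq_addr.
have sp : size p = h by rewrite size_takel // hb.
have sq : size q = h by rewrite size_takel // size_eval_inv hb.
have wb : word (u b) = p ++ inv_word q.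
  rewrite inv_word_take size_eval_inv hb // word_eval_inv inv_wordK.
  by rewrite -addnn addnK cat_take_drop.
have wb' : word (u (inv_letter b)) = q ++ inv_word p.
  by rewrite word_eval_inv wb inv_word_cat inv_wordK.
have vpq : word_value p = word_value q.
  apply/eqP; rewrite eqn_leq; apply/andP; split.
    rewrite eq_sym in ab1; apply: (overlap_half_value ab1 ua ub _ wb sp sq).
    by rewrite lcpC.
  exact: (overlap_half_value cb1 uc ub' hc wb' sq sp).
have pq : p = q by apply: word_value_inj => //; rewrite sp.
have := overlap_self ub; rewrite hb ltn_double ltnNge.
by rewrite lcp_ge ?size_eval_inv ?hb.
Qed.

(** Prepending a factor [u a] cancels only within the part kept from [u b], by
[overlap_sum], and leaves at least one letter of that part. The shape of the
product is recorded because the next factor cancels against it. *)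
Lemma word_prod_reduced a l :
  reduced (a :: l) -> all (fun b => u b != 1) (a :: l) ->
  exists2 rest, word (\prod_(b <- a :: l) u b)
    = take (size (word (u a))
            - (if l is b :: _ then ov (inv_letter a) b else 0%N))
           (word (u a)) ++ rest
  & (size l <= size rest)%N.
Proof.
elim: l a => [|b l IHl] a.
  by move=> _ _; exists [::]; rewrite // big_seq1 subn0 take_size cats0.
move=> rabl /= /andP[ua ubl].
have [rest wP lrest] := IHl b (reduced_behead rabl) ubl.
have /andP[ub _] := ubl.
have ab : inv_letter a != b by move: rabl => /andP[]; rewrite eq_sym.
have ua' : u (inv_letter a) != 1 by rewrite eval_letter_inv invg_eq1.
set k := (_ - _)%N in wP; set c := ov _ _.
have ck : (c < k)%N.
  rewrite /k; case: l {IHl lrest wP k} rabl ubl => [|d l] rabl ubl.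
    have := overlap_le ab ua'; have := ub; rewrite -word_eq0 subn0 -/c.
    by move: c (size (word (u b))) => y z; lia.
  have /and3P[_ db _] := rabl; have /and3P[_ ud _] := ubl.
  rewrite ltn_subRL addnC; exact: (overlap_sum ab db ua' ub ud).
have kb : (k <= size (word (u b)))%N by apply: leq_subr.
have cE : lcp (word (u (inv_letter a))) (word (\prod_(d <- b :: l) u d)) = c.
  by rewrite wP lcp_take // ck.
exists (drop c (take k (word (u b)) ++ rest)); last first.
  rewrite size_drop size_cat size_takel //.
  by move: lrest ck; move: (size l) (size rest) => m n; lia.
rewrite big_cons -{1}[u a]invgK -eval_letter_inv word_mulVg cE wP.
by rewrite inv_word_drop size_eval_inv word_eval_inv inv_wordK.
Qed.

Lemma size_prod_reduced a l :
  reduced (a :: l) -> all (fun b => u b != 1) (a :: l) ->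
  (size (a :: l) <= size (word (\prod_(b <- a :: l) u b)%g))%N.
Proof.
move=> ral ual; have [rest -> lrest] := word_prod_reduced ral ual.
rewrite size_cat -[size (a :: l)]/(1 + size l)%N leq_add //.
rewrite size_takel ?leq_subr // subn_gt0.
case: l ral ual {lrest} => [|b l] ral /andP[ua ubl].
  by rewrite lt0n word_eq0.
have /andP[ub _] := ubl.
have ba : b != inv_letter a by move: ral => /andP[].
have := overlap_le ba ub; rewrite size_eval_inv [lcp _ _]lcpC.
move: ua; rewrite -word_eq0.
by move: (lcp _ _) (size _) => y z; lia.
Qed.

End Nielsen.

Section NielsenConclusion.
Variables (I : choiceType) (X : finType) (f : I -> free_group X).

Hypothesis fmin : nielsen_minimal f.

(** A nonempty reduced product of nontrivial members has at least the length of
its number of factors, and a generator has length 1. *)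
Theorem nielsen_minimal_generator :
  (forall y, exists g, free_lift f g = y) ->
  forall x, exists a, eval_letter f a = free_gen x.
Proof.
move=> fsurj x; have [g gx] := fsurj (free_gen x).
have [[|a l] /andP[rw nt]] := free_lift_nontrivial_word f g; rewrite gx.
  by rewrite big_nil => /(congr1 (@word _)).
move=> xE; have := size_prod_reduced fmin rw nt; rewrite -xE.
by case: l xE {rw nt} => // xE _; exists a; rewrite xE big_seq1.
Qed.

(** If [f k] started with a letter [(x, s)], the member equal to this letter
could be used to cancel it, which shortens [f k]. *)
Theorem nielsen_minimal_trivial k :
  (forall x, exists2 a, eval_letter f a = free_gen x & a.1 != k) -> f k = 1.
Proof.
move=> fgen; apply/eqP; rewrite -word_eq0.
case kw : (word (f k)) => [//|[x s] w].
have [a ax ak] := fgen x.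
have [b wb bk] : exists2 b, word (eval_letter f b) = [:: (x, s)] & k != b.1.
  rewrite eq_sym in ak; case: s {kw}; first by exists a; rewrite ?ax.
  by exists (inv_letter a); rewrite // eval_letter_inv ax.
have := fmin (a := (k, true)) bk; rewrite leqNgt weight_lt_size //.
by rewrite size_mulVg wb kw /= eqxx; lia.
Qed.

End NielsenConclusion.

(** * Surjections between free groups of finite rank *)

(** The weights are natural numbers, so the total weight attains a minimum. *)
Lemma minimal_basis (n : nat) (X : finType) (G : groupType)
    (b0 : 'I_n -> G) (h : {ghom G -> free_group X}) :
  is_basis b0 -> exists2 b : 'I_n -> G, is_basis b & nielsen_minimal (h \o b).
Proof.
move=> b0B; pose total (b : 'I_n -> G) := (\sum_k weight (word (h (b k))))%N.
pose P N := `[< exists2 b, is_basis b & total b = N >].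
have exP : exists N, P N by exists (total b0); apply/asboolP; exists b0.
case: (ex_minnP exP) => N /asboolP[b bB bN] Nmin; exists b => // a c ac.
have [b' [b'B b'b b'a]] := is_basis_transvection bB ac.
have : (total b <= total b')%N.
  by rewrite bN; apply: Nmin; apply/asboolP; exists b'.
rewrite /total (bigD1 a.1) //= [X in (_ <= X)%N -> _](bigD1 a.1) //=.
under [X in (_ <= _ + X)%N -> _]eq_bigr => k ka do rewrite b'b //.
have hE : (eval_letter (h \o b) c)^-1 * eval_letter (h \o b) a
    = h (eval_letter b' a).
  by rewrite b'a gmulfM /= gmulfV !ghom_eval_letter.
have wE (d : 'I_n -> G) :
    weight (word (h (eval_letter d a))) = weight (word (h (d a.1))).
  by rewrite /eval_letter; case: ifP => // _; rewrite gmulfV weight_inv.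
by rewrite leq_add2r -wE -wE -hE (ghom_eval_letter h).
Qed.

Lemma extend_injection (m n : nat) (p : 'I_m -> 'I_n) : injective p ->
  exists q : 'I_n -> 'I_n, [/\ bijective q,
    forall (k : 'I_n) (i : 'I_m), k = i :> nat -> q k = p i
    & forall (k : 'I_n) (i : 'I_m), (m <= k)%N -> q k != p i].
Proof.
move=> pI; pose s := codom p ++ [seq k <- enum 'I_n | k \notin codom p].
have sU : uniq s.
  rewrite cat_uniq (map_inj_uniq pI) enum_uniq filter_uniq ?enum_uniq // andbT.
  by apply/hasPn => k; rewrite mem_filter => /andP[].
have ss : size s = n.
  rewrite -[RHS]card_ord cardE.
  apply/perm_size/uniq_perm; rewrite ?enum_uniq //.
  by move=> k; rewrite mem_cat mem_filter mem_enum andbT orbN.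
have sp : size (codom p) = m by rewrite size_codom card_ord.
exists (fun k => nth k s k); split=> [|k i ki|k i mk].
- apply: injF_bij => k k'; rewrite (set_nth_default k') ?ss // => /eqP.
  by rewrite nth_uniq ?ss // => /eqP/val_inj.
- rewrite nth_cat sp ki ltn_ord (nth_map i) ?size_enum_ord //.
  by rewrite nth_ord_enum.
rewrite nth_cat sp ltnNge mk /=; set t := [seq k <- _ | _].
have : nth k t (k - m) \in t.
  by rewrite mem_nth // -(ltn_add2l m) subnKC // -{1}sp -size_cat ss.
by rewrite mem_filter => /andP[+ _]; apply: contraNneq => ->; rewrite codom_f.
Qed.

(** The image of a basis of minimal weight contains each [B k] up to sign, and
its other members are trivial; it only remains to reorder the basis and to
correct the signs. *)
Theorem surjection_adapted_basis (G H : groupType) (n m : nat)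
    (b0 : 'I_n -> G) (B : nat -> H) (h : {ghom G -> H}) :
  is_basis b0 -> std_basis m B -> (forall y, exists x, h x = y) ->
  exists2 B' : nat -> G, std_basis n B' & forall k, h (B' k) = B k.
Proof.
move=> b0B [Bge BB] hsurj.
have [r [liftK rK]] := ghom_inverse BB.
have [b bB bmin] := minimal_basis (r \o h) b0B.
have /choice[a aP] :
    forall i, exists a, eval_letter (r \o h \o b) a = free_gen i.
  apply: (nielsen_minimal_generator bmin) => y.
  have [x xy] := hsurj (free_lift (fun k : 'I_m => B k) y).
  have [lb _ lbK] := bB; exists (lb x).
  by rewrite -ghom_free_lift /= lbK xy liftK.
(* Members with the same index are equal or inverse to each other, and distinct
   generators are neither. *)
have aI : injective (fun i => (a i).1).
  move=> i j ij; have [e|ne] := eqVneq (a i) (a j).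
    by have := aP i; rewrite e aP => /(congr1 (@word _))[].
  have := aP i; rewrite (inv_letter_index ij ne) eval_letter_inv aP.
  by move/(congr1 (@word _)).
have mn : (m <= n)%N by have := leq_card _ aI; rewrite !card_ord.
have [q [qB qp qNp]] := extend_injection aI.
pose sg (k : 'I_n) :=
  if insub (val k) is Some i then (a (i : 'I_m)).2 else true.
exists (extend (fun k => eval_letter b (q k, sg k))).
  by apply/std_basis_extend/is_basis_reindex.
move=> k; have [nk|kn] := leqP n k.
  by rewrite extend_ge // gmulf1 Bge // (leq_trans mn).
rewrite -[k]/(val (Ordinal kn)) extend_ord; set k' := Ordinal kn.
apply: (can_inj rK).
rewrite ghom_eval_letter (ghom_eval_letter r).
have [mk|km] := leqP m k'.
  rewrite Bge // gmulf1 /sg insubF ?ltnNge ?mk //.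
  rewrite /eval_letter /=; apply: (nielsen_minimal_trivial bmin) => i.
  by exists (a i) => //; rewrite eq_sym; apply: qNp.
rewrite /sg insubT (qp _ (Ordinal km)) // -surjective_pairing aP.
by rewrite -[LHS]liftK; congr (r _); apply: free_lift_gen.
Qed.

(** * Inverse limits of systems with compatible bases *)

Lemma dependent_choice_fun (I : Type) (T : I -> Type)
    (P : forall i, T i -> Prop) :
  (forall i, exists x, P i x) -> exists f : forall i, T i, forall i, P i (f i).
Proof.
move=> h; exists (fun i => projT1 (cid (h i))) => i.
exact: (projT2 (cid (h i))).
Qed.

(** Bases respected by the connecting homomorphisms. Since [B j k] is 1 for
[n j <= k], the second clause also says that the extra elements are killed. *)
Definition system_basis (S : inv_system nat) (n : nat -> nat)
    (B : forall i, nat -> inv_obj S i) :=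
  (forall i, std_basis (n i) (B i)) /\
  (forall i j (ji : (j <= i)%O) k, inv_map S ji (B i k) = B j k).

Section Limits.
Variables (S : inv_system nat) (n : nat -> nat).
Variable B : forall i, nat -> inv_obj S i.
Hypothesis SB : system_basis n B.

Lemma inv_limE (f : inv_lim S) i j (ji : (j <= i)%O) :
  inv_lim_fun f j = inv_map S ji (inv_lim_fun f i).
Proof. by have /asboolP := valP f; apply. Qed.

(** Two coordinates of a thread are compared through a common later coordinate,
where homomorphisms are determined by the basis. *)
Lemma inv_lim_hom_eq (H : groupType) i j
    (h : {ghom inv_obj S i -> H}) (k : {ghom inv_obj S j -> H})
    (f : inv_lim S) :
  (forall l, h (B i l) = k (B j l)) ->
  h (inv_lim_fun f i) = k (inv_lim_fun f j).
Proof.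
move=> hk; pose a := maxn i j.
have ia : (i <= a)%O by rewrite leEnat leq_maxl.
have ja : (j <= a)%O by rewrite leEnat leq_maxr.
rewrite (inv_limE f ia) (inv_limE f ja).
apply: (std_basis_hom_ext (SB.1 a)
  (h := h \o inv_map S ia) (k := k \o inv_map S ja)).
by move=> l /=; rewrite !SB.2.
Qed.

Definition inv_lim_proj i : inv_lim S -> inv_obj S i :=
  fun f => inv_lim_fun f i.

Fact inv_lim_proj_morphism i : monoid_morphism (inv_lim_proj i).
Proof. by []. Qed.

HB.instance Definition _ i :=
  isUMagmaMorphism.Build (inv_lim S) (inv_obj S i) (inv_lim_proj i)
    (inv_lim_proj_morphism i).

Lemma inv_lim_hom (T : groupType) (h : forall i, {ghom T -> inv_obj S i}) :
  (forall i j (ji : (j <= i)%O) x, h j x = inv_map S ji (h i x)) ->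
  exists H : {ghom T -> inv_lim S}, forall x i, inv_lim_fun (H x) i = h i x.
Proof.
move=> hC.
have hP x : compatible (fun i => h i x : inv_obj S i).
  by apply/asboolP => i j ji; apply: hC.
pose H x := InvLim (hP x).
have HM : monoid_morphism H.
  by split=> [|x y]; apply/val_inj/functional_extensionality_dep => i /=;
    [apply: gmulf1 | apply: gmulfM].
pose HI := isUMagmaMorphism.Build T (inv_lim S) H HM.
pose H' : {ghom T -> inv_lim S} := HB.pack H HI.
by exists H'.
Qed.

Lemma inv_lim_ext (f g : inv_lim S) :
  (forall i, inv_lim_fun f i = inv_lim_fun g i) -> f = g.
Proof. by move=> fg; apply/val_inj/functional_extensionality_dep. Qed.

(** The maps from the group number [i0] to the others that match the bases lift
each of its elements to a thread, the only one through this element. *)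
Lemma inv_lim_bounded i0 :
  (forall i, n i <= n i0)%N -> bijective (inv_lim_proj i0).
Proof.
move=> nmax.
have /dependent_choice_fun[t tB] :
    forall i, exists h : {ghom inv_obj S i0 -> inv_obj S i},
    forall k, h (B i0 k) = B i k.
  by move=> i; apply: std_basis_hom (SB.1 i0) (SB.1 i) (nmax i).
have [|H HE] := inv_lim_hom (h := t).
  move=> i j ji.
  apply: (std_basis_hom_ext (SB.1 i0) (k := inv_map S ji \o t i)).
  by move=> k /=; rewrite !tB SB.2.
have pH : cancel H (inv_lim_proj i0).
  move=> x; rewrite /inv_lim_proj HE.
  by apply: (std_basis_hom_ext (SB.1 i0) (k := idfun)) => k; rewrite tB.
exists H => // f; apply: inv_lim_ext => i; rewrite HE.
by apply: (inv_lim_hom_eq (k := idfun)) => k; rewrite tB.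
Qed.

End Limits.

Section Comparison.
Variables (S T : inv_system nat) (n m : nat -> nat).
Variables (B : forall i, nat -> inv_obj S i) (C : forall j, nat -> inv_obj T j).

(** This determines [H] as soon as each rank of [T] is bounded by some rank of
[S]. Asking it for all pairs [i], [j] at once makes [H] independent of the
choice of a coordinate [i] for each [j]. *)
Definition matches_bases (H : inv_lim S -> inv_lim T) :=
  forall f i j (h : {ghom inv_obj S i -> inv_obj T j}),
    (forall k, h (B i k) = C j k) -> inv_lim_fun (H f) j = h (inv_lim_fun f i).

Lemma exists_matches_bases :
  system_basis n B -> system_basis m C -> (forall j, exists i, m j <= n i)%N ->
  exists H : {ghom inv_lim S -> inv_lim T}, matches_bases H.
Proof.
move=> SB TC /choice[c cP].
have /dependent_choice_fun[t tB] :
    forall j, exists h : {ghom inv_obj S (c j) -> inv_obj T j},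
    forall k, h (B (c j) k) = C j k.
  by move=> j; apply: std_basis_hom (SB.1 (c j)) (TC.1 j) (cP j).
have [|H HE] := inv_lim_hom (h := fun j => t j \o inv_lim_proj (c j)).
  move=> i j ji f.
  apply: (inv_lim_hom_eq SB (h := t j) (k := inv_map T ji \o t i)).
  by move=> k /=; rewrite !tB TC.2.
exists H => f i j h hB; rewrite HE.
by apply: (inv_lim_hom_eq SB) => k; rewrite tB hB.
Qed.

End Comparison.

(** Going from a coordinate [i'] of [S] to a coordinate [j] of [T] and back to
[i] matches the basis with itself, so it computes coordinate [i] from [i']. *)
Lemma matches_basesK (S T : inv_system nat) (n m : nat -> nat)
    (B : forall i, nat -> inv_obj S i) (C : forall j, nat -> inv_obj T j)
    (H : inv_lim S -> inv_lim T) (K : inv_lim T -> inv_lim S) :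
  system_basis n B -> system_basis m C ->
  (forall j, exists i, m j <= n i)%N -> (forall i, exists j, n i <= m j)%N ->
  matches_bases B C H -> matches_bases C B K -> cancel H K.
Proof.
move=> SB TC mn nm HE KE f; apply: inv_lim_ext => i.
have [j nimj] := nm i; have [i' mjni'] := mn j.
have [k kC] := std_basis_hom (TC.1 j) (SB.1 i) nimj.
have [h hB] := std_basis_hom (SB.1 i') (TC.1 j) mjni'.
rewrite (KE _ _ _ _ kC) (HE _ _ _ _ hB).
by apply: (inv_lim_hom_eq SB (h := k \o h) (k := idfun)) => l /=; rewrite hB kC.
Qed.

Theorem inv_lim_isomorphic (S T : inv_system nat) (n m : nat -> nat)
    (B : forall i, nat -> inv_obj S i) (C : forall j, nat -> inv_obj T j) :
  system_basis n B -> system_basis m C ->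
  (forall j, exists i, m j <= n i)%N -> (forall i, exists j, n i <= m j)%N ->
  group_isomorphic (inv_lim S) (inv_lim T).
Proof.
move=> SB TC mn nm.
have [H HE] := exists_matches_bases SB TC mn.
have [K KE] := exists_matches_bases TC SB nm.
exists H; exists K; first exact: (matches_basesK SB TC).
exact: (matches_basesK TC SB).
Qed.

(** * The two possible limits *)

Lemma hawaiian_system_basis :
  @system_basis hawaiian_system succn (fun i => extend (@hawaiian_gen i)).
Proof.
split=> [i|i j ji k]; first exact/std_basis_extend/is_basis_free_gen.
have ji' : (j <= i)%N by rewrite -leEnat.
have [ik|ki] := leqP i.+1 k.
  by rewrite !extend_ge ?gmulf1 // (leq_trans _ ik).
rewrite -[k]/(val (Ordinal ki)) extend_ord.
have [jk|kj] := leqP j.+1 k.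
  by rewrite extend_ge // [LHS]hawaiian_map_gen1.
by rewrite -[val _]/(val (Ordinal kj)) extend_ord; apply: hawaiian_map_gen.
Qed.

(** The bases are built by recursion, each adapted to the preceding one. *)
Lemma exists_system_basis (F : inv_system nat) :
  (forall i, free_of_finite_rank (inv_obj F i)) ->
  (forall i j (ji : (j <= i)%O) (y : inv_obj F j),
     exists x, inv_map F ji x = y) ->
  exists n B, @system_basis F n B.
Proof.
move=> /choice[n nP] Fsurj; exists n.
have basis i : exists b : 'I_(n i) -> inv_obj F i, is_basis b.
  have [f fB] := nP i; have [g [fK gK]] := ghom_inverse fB.
  have gB : bijective g by exists f.
  exists (g \o @free_gen _); apply: (eq_bij gB).
  by apply: free_lift_unique.
have le_succ i : (i <= i.+1)%O by rewrite leEnat.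
pose D i := {B : nat -> inv_obj F i | std_basis (n i) B}.
have [d0] : inhabited (D 0%N).
  have [b bB] := basis 0%N; exists; exists (extend b).
  exact: std_basis_extend.
have step i (d : D i) : exists d' : D i.+1,
    forall k, inv_map F (le_succ i) (sval d' k) = sval d k.
  have [b bB] := basis i.+1.
  have [B' B'B B'h] :=
    surjection_adapted_basis bB (svalP d) (Fsurj _ _ (le_succ i)).
  by exists (exist _ B' B'B).
have /dependent_choice_fun[next nextP] : forall i, exists s : D i -> D i.+1,
    forall d k, inv_map F (le_succ i) (sval (s d) k) = sval d k.
  by move=> i; have [s sP] := choice (step i); exists s.
pose d := nat_rect D d0 next; exists (fun i => sval (d i)).
split=> [i|i j]; first exact: (svalP (d i)).
(* A surjective idempotent map is the identity. *)
have map_id a (aa : (a <= a)%O) x : inv_map F aa x = x.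
  by have [y <-] := Fsurj _ _ aa x; apply: inv_map_comp.
elim: i => [|i IHi] ji k.
  have j0 : j = 0%N by move: ji; rewrite leEnat leqn0 => /eqP.
  by move: ji; rewrite j0 => ji; apply: map_id.
have [ij|ji'] := leqP i.+1 j.
  have jE : j = i.+1 by apply/eqP; rewrite eqn_leq ij andbT.
  by move: ji; rewrite jE => ji; apply: map_id.
rewrite -(inv_map_comp (le_succ i) (ji' : (j <= i)%O) ji).
by rewrite nextP IHi.
Qed.

Theorem proposition2p1 (F : inv_system nat)
    (hfree : forall i : nat, free_of_finite_rank (inv_obj F i))
    (hsurj : forall (i j : nat) (ji : (j <= i)%O) (y : inv_obj F j),
       exists x : inv_obj F i, inv_map F ji x = y) :
  group_isomorphic (inv_lim F) hawaiian \/ free_of_finite_rank (inv_lim F).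
Proof.
have [n [B FB]] := exists_system_basis hfree hsurj.
have [unbounded|/existsNP[N /forallNP bounded]] :=
    pselect (forall j, exists i, (j.+1 <= n i)%N).
  left; apply: (inv_lim_isomorphic FB hawaiian_system_basis unbounded) => i.
  by exists (n i).
right.
pose P r := `[< exists i, n i = r >].
have exP : exists r, P r by exists (n 0%N); apply/asboolP; exists 0%N.
have leP r : P r -> (r <= N)%N.
  by move=> /asboolP[i <-]; rewrite leqNgt; apply/negP/bounded.
case: (ex_maxnP exP leP) => r /asboolP[i0 <-] nmax.
have projB : bijective (@inv_lim_proj F i0).
  by apply: (inv_lim_bounded FB) => i; apply: nmax; apply/asboolP; exists i.
have [k [f fB]] := hfree i0; exists k, (f \o @inv_lim_proj F i0).
exact: bij_comp fB projB.
Qed.
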